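(* Let $\mathbf w\in\mathbb{Z}^{m}$ be an integer vector indexed by $E(G)$, and for a positive integer $q$ let $w=[\mathbf w]_q:E(G)\to\mathbb{Z}_q$. The following hold. (1) For every positive integer $q$, $$\#C(G,w;\mathbb{Z}_q)=\sum_{S\subseteq E(G)}(-1)^{|S|}\tilde{d}_S(q)\,q^{c(G|S)}.$$ Moreover, there exists a polynomial $\chi(G,w;t)$ (depending on $G$, its orientation and $\mathbf w$) such that $\#C(G,w;\mathbb{Z}_q)=\chi(G,w;q)$ for all integers $q>q_{\mathbf w}$, and $\chi(G,w;t)$ can be written as $$\chi(G,w;t)=\sum_{S\subseteq E(G),\ r([M_G^T,\mathbf w]_S)=r(G|S)}(-1)^{|S|}t^{c(G|S)}.$$ (2) $\chi(G,w;t)=\chi(\mathcal{A}_{(G,\mathbf w)},t)$. (3) For any positive integers $p,q$, with $w=[\mathbf w]_q$ and $w'=[\mathbf w]_{pq}$, we have $\#C(G,w;\mathbb{Z}_q)\le \#C(G,w';\mathbb{Z}_{pq})$.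
   Context: $G$ is a finite graph, multiple edges and loops allowed, with vertex set $V(G)=\{1,\dots,n\}$ and $m=|E(G)|$ edges, equipped with a fixed orientation. For $S\subseteq E(G)$, $G|S$ is the spanning subgraph with edge set $S$, $c(G|S)$ is its number of connected components, and $r(G|S)=|V(G)|-c(G|S)$. $\mathbb{Z}_q=\mathbb{Z}/q\mathbb{Z}$ and $[\cdot]_q$ denotes entrywise reduction modulo $q$. For $w:E(G)\to\mathbb{Z}_q$, a $(\mathbb{Z}_q,w)$-coloring of $G$ is a map $c:V(G)\to\mathbb{Z}_q$ such that for each edge $e$ oriented from $u$ to $v$ one has $c(v)-c(u)\ne w(e)$. $C(G,w;\mathbb{Z}_q)$ is the set of all $(\mathbb{Z}_q,w)$-colorings. The incidence matrix $M_G=(m_{ve})$ is the $n\times m$ matrix with $m_{ve}=1$ if $e$ is a non-loop edge with head $v$, $-1$ if $e$ is a non-loop edge with tail $v$, and $0$ otherwise. $[M_G^T,\mathbf w]$ is $M_G^T$ augmented by the column $\mathbf w$; for $S\subseteq E(G)$, $[M_G^T,\mathbf w]_S$ is its submatrix of rows indexed by $S$, and $r(\cdot)$ of a matrix is its rank. For an integer matrix $N$ of positive rank, $d(N)$ is its largest invariant factor (the last nonzero diagonal entry of its Smith normal form, taken positive). Put $$q_{\mathbf w}=\max\{d([M_G^T,\mathbf w]_S): S\subseteq E(G),\ r([M_G^T,\mathbf w]_S)\ne r(G|S)\}$$ (with $q_{\mathbf w}=0$ if there is no such $S$). Let $\tilde d_S(q)=1$ if $r([M_G^T,\mathbf w]_S)=r(G|S)$;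 $\tilde d_S(q)=1$ if $r([M_G^T,\mathbf w]_S)\ne r(G|S)$ and $d([M_G^T,\mathbf w]_S)\equiv 0\pmod q$; and $\tilde d_S(q)=0$ otherwise. The affinographic arrangement $\mathcal{A}_{(G,\mathbf w)}$ in $\mathbb{R}^n$ consists of $H_e=\{\mathbf x\in\mathbb{R}^n: x_j-x_i=w_e\}$ for each edge $e$ oriented from $i$ to $j$ ($w_e$ the entry of $\mathbf w$ at $e$); for a loop $e$ this is $\mathbb{R}^n$ if $w_e=0$ and $\emptyset$ otherwise. Its characteristic polynomial is $\chi(\mathcal{A}_{(G,\mathbf w)},t)=\sum_{S}(-1)^{|S|}t^{\dim(\bigcap_{e\in S}H_e)}$, the sum over $S\subseteq E(G)$ with $\bigcap_{e\in S}H_e\ne\emptyset$ (the intersection for $S=\emptyset$ being $\mathbb{R}^n$). *)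

(* Defs.v *)
From HB Require Import structures.
From mathcomp Require Import all_boot all_order all_algebra.
From mathcomp Require Import boolp classical_sets reals.

Set Implicit Arguments.
Unset Strict Implicit.
Unset Printing Implicit Defensive.

Import GRing.Theory.
Local Open Scope ring_scope.

(** Z/qZ for 0 < q.  Only the additive group is needed; ['Z_q] is avoided
    because ['Z_1] is Z/2Z. *)
Notation Zmod q := 'I_(q.-1.+1).

Definition redmod (q : nat) (z : int) : Zmod q := inZp `|(z %% q)%Z|%N.

(** Oriented multigraph, loops allowed, on vertices ['I_n] and edges ['I_m];
    [e] is oriented from [etail e] to [ehead e]. *)
Record ograph (n m : nat) := OGraph {
  etail : 'I_m -> 'I_n;
  ehead : 'I_m -> 'I_n
}.

Section Graph.
Variables (n m : nat) (G : ograph n m).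

Definition spanning_adj (S : {set 'I_m}) : rel 'I_n := fun u v =>
  [exists e in S, ((etail G e == u) && (ehead G e == v))
               || ((etail G e == v) && (ehead G e == u))].

Definition ncomp (S : {set 'I_m}) : nat := n_comp (spanning_adj S) 'I_n.

Definition grank (S : {set 'I_m}) : nat := (n - ncomp S)%N.

Definition colorings (q : nat) (w : 'I_m -> Zmod q) : {set {ffun 'I_n -> Zmod q}} :=
  [set c : {ffun 'I_n -> Zmod q} |
     [forall e, c (ehead G e) - c (etail G e) != w e]]%SET.

Definition incidence : 'M[int]_(n, m) :=
  \matrix_(v, e) if etail G e == ehead G e then 0
                 else if v == ehead G e then 1
                 else if v == etail G e then - 1
                 else 0.

Definition augmented (w : 'cV[int]_m) : 'M[int]_(m, n + 1) :=
  row_mx incidence^T w.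

End Graph.

Definition rows (m p : nat) (S : {set 'I_m}) (A : 'M[int]_(m, p)) :
    'M[int]_(#|S|, p) :=
  rowsub (fun i : 'I_#|S| => enum_val i) A.

Definition int_rank (m p : nat) (A : 'M[int]_(m, p)) : nat :=
  \rank (map_mx intr A : 'M[rat]_(m, p)).

Definition smith_diag (m p : nat) (A : 'M[int]_(m, p)) : seq int :=
  let: existT2 _ _ (existT2 _ _ (exist2 d _ _)) := int_Smith_normal_form A in d.

(** [smith_diag A] may be longer or shorter than the diagonal: entries past it
    are meaningless and missing ones are zero. *)
Definition largest_invariant_factor (m p : nat) (A : 'M[int]_(m, p)) : nat :=
  absz (last 0 [seq x <- take (minn m p) (smith_diag A) | x != 0]).

Section Quasi.
Variables (n m : nat) (G : ograph n m) (w : 'cV[int]_m).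

Definition rank_eq (S : {set 'I_m}) : bool :=
  int_rank (rows S (augmented G w)) == grank G S.

Definition dfactor (S : {set 'I_m}) : nat :=
  largest_invariant_factor (rows S (augmented G w)).

Definition qbound : nat := \max_(S : {set 'I_m} | ~~ rank_eq S) dfactor S.

Definition dtilde (S : {set 'I_m}) (q : nat) : int :=
  if rank_eq S then 1 else if (q %| dfactor S)%N then 1 else 0.

End Quasi.

Section Arrangement.
Variables (R : realType) (n : nat).

(** Dimension of a nonempty affine subspace [X = p + U]: that of its
    direction [U] (junk value [0] for other sets). *)
Definition affine_dim (X : set 'rV[R]_n) : nat :=
  xget 0%N [set d | exists (p : 'rV[R]_n) (U : {vspace 'rV[R]_n}),
                      X = [set x | x - p \in U] /\ \dim U = d]%classic.

Variables (m : nat) (G : ograph n m) (w : 'cV[int]_m).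

Definition affino_hyperplane (e : 'I_m) : set 'rV[R]_n :=
  [set x : 'rV[R]_n | x 0 (ehead G e) - x 0 (etail G e) = (w e 0)%:~R]%classic.

Definition flat (S : {set 'I_m}) : set 'rV[R]_n :=
  (\bigcap_(e in [set` S]) affino_hyperplane e)%classic.

Definition arr_charpoly : {poly int} :=
  \sum_(S : {set 'I_m} | `[< (flat S !=set0)%classic >])
     (-1) ^+ #|S| *: 'X^(affine_dim (flat S)).

End Arrangement.

(* Main.v *)
(** Inclusion-exclusion reduces the count of colorings to the number, for each
    edge set [S], of solutions of [A x = w] modulo [q], where [A] is the
    transposed incidence matrix of [S].  Summing edges along paths gives an
    integer matrix [Q] with [A Q A = A], so that the whole obstruction is
    carried by the integer vector [v = w - A Q w]: the system is solvable over a
    field of characteristic zero iff [v = 0], which is also when [A | w] and [A]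
    have the same rank, and it is solvable modulo [q] iff [q] divides [v].  When
    [v <> 0], the largest invariant factor of [A | w] is the exponent of the
    torsion of the cokernel of [A | w], which is the gcd of the entries of [v].
    A solvable system has one solution for each choice of a constant on each
    component, hence [q ^ c(G|S)] solutions modulo [q] and a flat of dimension
    [c(G|S)] over the reals. *)
Require Import Defs.
From HB Require Import structures.
From mathcomp Require Import all_boot all_order all_algebra.
From mathcomp Require Import boolp classical_sets reals.
From mathcomp Require Import ring.

Set Implicit Arguments.
Unset Strict Implicit.
Unset Printing Implicit Defensive.

Import GRing.Theory Num.Theory.

Local Open Scope ring_scope.

(** * Invariant factors *)

Lemma dvdz_sum (I : finType) (F : I -> int) (d : int) :
  (forall i, (d %| F i)%Z) -> (d %| \sum_i F i)%Z.
Proof.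
move=> dF; elim/big_ind: _ => [|x y dx dy|//]; first exact: dvdz0.
by rewrite rpredD.
Qed.

Lemma sorted_dvdz_last (s : seq int) (x : int) :
  sorted dvdz s -> x \in s -> (x %| last 0 s)%Z.
Proof.
move=> s_sorted xs; rewrite -nth_last -[X in (X %| _)%Z](nth_index 0 xs).
have tr : transitive dvdz by move=> a b c; apply: dvdz_trans.
have rf : reflexive dvdz by move=> a; apply: dvdzz.
have lt_ix : (index x s < size s)%N by rewrite index_mem.
apply: (sorted_leq_nth tr rf 0 s_sorted); rewrite ?inE //.
  by rewrite prednK ?leqnn // (leq_ltn_trans _ lt_ix).
by rewrite -ltnS prednK // (leq_ltn_trans _ lt_ix).
Qed.

(** Cutting the Smith diagonal at [minn k p] discards its meaningless entries without changing the
    matrix. The divisibility chain then makes the last nonzero entry a multiple of every other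
    nonzero one. *)
Lemma smith_decomposition (k p : nat) (M : 'M[int]_(k, p)) :
  exists (L : 'M[int]_k) (R : 'M[int]_p) (s : seq int),
    [/\ L \in unitmx, R \in unitmx,
        M = L *m (\matrix_(i, j) (s`_i *+ (i == j :> nat))) *m R,
        forall i, s`_i != 0 -> (absz (s`_i)%R %| largest_invariant_factor M)%N
      & M != 0 -> exists2 r, (r < minn k p)%N
                           & s`_r != 0 /\ absz s`_r = largest_invariant_factor M].
Proof.
rewrite /largest_invariant_factor /smith_diag.
case: int_Smith_normal_form => L uL [R uR [d d_sorted defM]].
pose s := take (minn k p) d; pose t := [seq x <- s | x != 0].
have tr : transitive dvdz by move=> a b c; apply: dvdz_trans.
have {}defM : M = L *m (\matrix_(i, j) (s`_i *+ (i == j :> nat))) *m R.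
  rewrite defM; congr (_ *m _ *m _); apply/matrixP=> i j; rewrite !mxE.
  by case: eqP => //= eij; rewrite nth_take // leq_min ltn_ord eij ltn_ord.
exists L, R, s; split=> // [i si0|M0].
  rewrite -dvdzE sorted_dvdz_last ?sorted_filter ?take_sorted //.
  rewrite mem_filter si0 mem_nth // ltnNge.
  by apply: contra si0 => le_si; rewrite nth_default.
have t0 : t != [::].
  apply: contraNneq M0 => t0; rewrite defM.
  suff -> : \matrix_(i < k, j < p) (s`_i *+ (i == j :> nat)) = 0.
    by rewrite mulmx0 mul0mx.
  apply/matrixP=> i j; rewrite !mxE; case: (ltnP i (size s)) => [lt_is|le_si].
    have /negP : ~ (s`_i \in t) by rewrite t0.
    by rewrite mem_filter mem_nth // andbT negbK => /eqP->; rewrite mul0rn.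
  by rewrite nth_default // mul0rn.
have : last 0 t \in t by case: (t) t0 => //= a l _; apply: mem_last.
rewrite mem_filter -/s -/t => /andP[last0 last_s]; exists (index (last 0 t) s).
  by rewrite (leq_trans (_ : _ < size s)%N) ?index_mem // size_take_min geq_minl.
by rewrite nth_index.
Qed.

(* The largest invariant factor is the exponent of the torsion subgroup of the
   cokernel of [M]. *)
Lemma largest_invariant_factor_kills_torsion (k p : nat) (M : 'M[int]_(k, p))
    (c : int) (y : 'cV_k) (x : 'cV_p) :
  c != 0 -> c *: y = M *m x ->
  exists z, (largest_invariant_factor M)%:Z *: y = M *m z.
Proof.
move=> c0; have [L [R [s [uL uR defM dv _]]]] := smith_decomposition M.
set D := \matrix_(i, j) _ in defM; set f := largest_invariant_factor M in dv *.
move=> e; pose y' := invmx L *m y.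
have e' : c *: y' = D *m (R *m x).
  by rewrite scalemxAr e defM !mulmxA mulVmx // mul1mx.
have DE (u : 'cV_p) (i : 'I_k) (j : 'I_p) : i = j :> nat ->
    (D *m u) i 0 = s`_i * u j 0.
  move=> eij; rewrite mxE (bigD1 j) //= mxE eij eqxx mulr1n big1 ?addr0 // => l.
  rewrite mxE eij => /negbTE l_j; rewrite [(j == l :> nat)]eq_sym.
  by rewrite -[(l == j :> nat)]/(l == j) l_j mul0r.
have D0 (u : 'cV_p) (i : 'I_k) : (p <= i)%N -> (D *m u) i 0 = 0.
  move=> le_pi; rewrite mxE big1 // => l _; rewrite mxE.
  by rewrite (gtn_eqF (leq_trans (ltn_ord l) le_pi)) mul0r.
have E i : c * y' i 0 = (D *m (R *m x)) i 0 by rewrite -e' [RHS]mxE.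
(* In these coordinates [c * y'_i = s_i * (R x)_i], so [y'_i = 0] wherever [s_i = 0], and elsewhere
   [s_i] divides [f]. A column index with no matching row gets the value [0]. *)
pose z' : 'cV[int]_p := \col_j
  (if insub (val j) is Some i then (f%:Z %/ s`_j)%Z * y' i 0 else 0).
have fy' : f%:Z *: y' = D *m z'.
  apply/colP=> i; rewrite [LHS]mxE; have [lt_ip|le_pi] := ltnP i p; last first.
    have /eqP := E i; rewrite D0 // mulf_eq0 (negbTE c0) => /eqP->.
    by rewrite mulr0 D0.
  rewrite (DE z' i (Ordinal lt_ip)) // [z' _ _]mxE /= valK.
  have [si0|si_n0] := eqVneq s`_i 0.
    have /eqP := E i; rewrite (DE _ i (Ordinal lt_ip)) // si0 mul0r.
    by rewrite mulf_eq0 (negbTE c0) => /eqP->; rewrite !mulr0.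
  by rewrite mulrA [s`_i * _]mulrC divzK // dvdzE /= dv.
exists (invmx R *m z'); rewrite defM -!mulmxA (mulmxA R) mulmxV // mul1mx -fy'.
by rewrite -scalemxAr mulmxA mulmxV // mul1mx.
Qed.

(** The bound is reached on one torsion class: the basis vector at the position [r] of the last
    nonzero invariant factor has exactly that factor as its order in the cokernel. *)
Lemma largest_invariant_factor_min (k p : nat) (M : 'M[int]_(k, p)) (N : int) :
    M != 0 ->
    (forall (c : int) (y : 'cV_k) (x : 'cV_p), c != 0 -> c *: y = M *m x ->
       exists z, N *: y = M *m z) ->
  ((largest_invariant_factor M)%:Z %| N)%Z.
Proof.
have [L [R [s [uL uR defM dv]]]] := smith_decomposition M.
set D := \matrix_(i, j) _ in defM => ex_r M0 torN.
have [r] := ex_r M0; rewrite leq_min => /andP[lt_rk lt_rp] [sr_n0 fE].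
have DE (u : 'cV_p) : (D *m u) (Ordinal lt_rk) 0 = s`_r * u (Ordinal lt_rp) 0.
  rewrite mxE (bigD1 (Ordinal lt_rp)) //= mxE eqxx mulr1n big1 ?addr0 // => l.
  by move=> /negbTE l_r; rewrite mxE [_ == _ :> nat]eq_sym [_ == _ :> nat]l_r mul0r.
have [|z] := torN s`_r (L *m delta_mx (Ordinal lt_rk) 0)
  (invmx R *m delta_mx (Ordinal lt_rp) 0) sr_n0.
  rewrite defM -!mulmxA (mulmxA R) mulmxV // mul1mx scalemxAr; congr (_ *m _).
  apply/colP=> i; rewrite !mxE (bigD1 (Ordinal lt_rp)) //= big1 => [|l /negbTE lr].
    rewrite !mxE !eqxx addr0 mulr1 -[i == _]/(i == r :> nat).
    by case: eqP => [->|_]; rewrite ?mulr1 ?mulr0.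
  by rewrite !mxE lr mulr0.
rewrite dvdzE /= -fE defM scalemxAr -!mulmxA => /(congr1 (mulmx (invmx L))).
rewrite !mulmxA mulVmx // !mul1mx -mulmxA => /colP/(_ (Ordinal lt_rk)).
rewrite DE !mxE !eqxx mulr1 => ->; by rewrite abszM dvdn_mulr.
Qed.

Lemma scalemx_inj (R : idomainType) (m n : nat) (a : R) :
  a != 0 -> injective ( *:%R a : 'M_(m, n) -> 'M_(m, n)).
Proof.
move=> a0 X Y /eqP; rewrite -subr_eq0 -scalerBr scalemx_eq0 (negbTE a0) subr_eq0.
by move/eqP.
Qed.

(** Up to sign, [g] is the gcd of the entries of [v] and [a] is a row of Bezout coefficients. Both
    come from the Smith form of a single column, whose only diagonal entry is [g]. *)
Lemma column_gcd (k : nat) (v : 'cV[int]_k) :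
  exists (g : int) (a : 'rV[int]_k) (u : 'cV[int]_k),
    v = g *: u /\ a *m v = g%:M.
Proof.
case: k v => [|k] v.
  exists 0, 0, 0; rewrite [v]flatmx0 scale0r mul0mx.
  by split=> //; apply/matrixP=> i j; rewrite !mxE mul0rn.
have [L [R [s [uL uR defv _ _]]]] := smith_decomposition v.
exists s`_0, (invmx R *m delta_mx 0 0 *m invmx L), (L *m delta_mx 0 0 *m R).
have defD : \matrix_(i < k.+1, j < 1) (s`_i *+ (i == j :> nat))
             = s`_0 *: delta_mx 0 0.
  apply/matrixP=> i j; rewrite !ord1 !mxE eqxx andbT -[i == 0]/(i == 0%N :> nat).
  by case: eqP => [->|_]; rewrite ?mulr1 ?mulr0.
split; first by rewrite {1}defv defD -scalemxAr -scalemxAl.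
rewrite defv defD !mulmxA mulmxKV // -scalemxAr -scalemxAl -!mulmxA.
rewrite (mulmxA (delta_mx 0 0)) mul_delta_mx.
have -> : delta_mx 0 0 = 1%:M :> 'M[int]_1.
  by apply/matrixP=> i j; rewrite !ord1 !mxE.
by rewrite mul1mx mulVmx // scalemx1.
Qed.

(** * Solvability of integer linear systems through a generalized inverse *)

Section GeneralizedInverse.

Variables (k n : nat) (A : 'M[int]_(k, n)) (Q : 'M[int]_(n, k)) (w : 'cV[int]_k).

Local Notation P := (1%:M - A *m Q).
Local Notation defect := (P *m w).

Hypothesis AQA : A *m Q *m A = A.

Lemma ginv_defect_mul : P *m A = 0.
Proof. by rewrite mulmxBl mul1mx AQA subrr. Qed.

Lemma ginv_decomposition (y : 'cV_k) : y = A *m (Q *m y) + P *m y.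
Proof. by rewrite mulmxBl mul1mx mulmxA addrC subrK. Qed.

(** Let [d] be the largest invariant factor and [g] the gcd of the defect. Multiplication by [g]
    kills the torsion of the cokernel of [[A | w]], so [d] divides [g]. Conversely, if the defect is
    [q u], then [u] is a torsion class, so [d u] lies in the image of [[A | w]]; applying [P] gives
    [d u = q t u] for an integer [t], whence [q] divides [d]. *)
Lemma dvd_largest_invariant_factor_row_mx (q : nat) :
  defect != 0 ->
  (q %| largest_invariant_factor (row_mx A w))%N
    <-> forall i, (q %| (defect i 0)%R)%Z.
Proof.
move=> v0; have PB z : P *m (row_mx A w *m z) = defect *m dsubmx z.
  by rewrite -[z in LHS]vsubmxK mul_row_col mulmxDr !mulmxA ginv_defect_mul mul0mx add0r.
split=> [q_d | q_v].
  have [g [a [u [vE avE]]]] := column_gcd defect.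
  suff d_g : ((largest_invariant_factor (row_mx A w))%:Z %| g)%Z.
    by move=> i; rewrite vE mxE dvdz_mulr // (dvdz_trans _ d_g).
  apply: largest_invariant_factor_min => [|c y x c0 e].
    apply: contraNneq v0 => B0; have w0 : w = 0 by rewrite -(row_mxKr A w) B0 linear0.
    by rewrite w0 mulmx0.
  pose s := a *m P *m y.
  have e1 : c *: (P *m y) = defect *m dsubmx x by rewrite scalemxAr e PB.
  have e2 : c *: s = g *: dsubmx x.
    by rewrite /s -mulmxA scalemxAr e1 mulmxA avE mul_scalar_mx.
  have e3 : g *: (P *m y) = defect *m s.
    apply: (scalemx_inj c0).
    by rewrite scalerA mulrC -scalerA e1 [RHS]scalemxAr e2 scalemxAr.
  (* Split [y = A Q y + P y]; by [e3], [g P y] is the defect times [s], that is [w s - A Q w s]. *)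
  exists (col_mx (g *: (Q *m y) - Q *m w *m s) s).
  rewrite mul_row_col {1}(ginv_decomposition y) scalerDr e3 mulmxBr -scalemxAr.
  rewrite -[X in _ + X]mulmxA [X in _ + X]mulmxBl mul1mx.
  by rewrite !mulmxA -addrA [- _ + _]addrC.
pose u := \col_i ((defect i 0)%R %/ q)%Z.
have vE : defect = q%:Z *: u.
  by apply/colP=> i; rewrite [RHS]mxE [u _ _]mxE mulrC divzK.
have q0 : q%:Z != 0 by apply: contraNneq v0 => q0; rewrite vE q0 scale0r.
(* [P] is idempotent, so it fixes the defect [q u], and [q] can be cancelled. *)
have Pu : P *m u = u.
  apply: (scalemx_inj q0); rewrite scalemxAr -vE mulmxA mulmxBr.
  by rewrite mulmx1 mulmxA ginv_defect_mul mul0mx subr0.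
have [|z e] := @largest_invariant_factor_kills_torsion _ _ (row_mx A w) q%:Z u
  (col_mx (- (Q *m w)) 1%:M) q0.
  by rewrite -vE mul_row_col mulmx1 mulmxN mulmxA [RHS]addrC mulmxBl mul1mx.
have [i ui0] : exists i, u i 0 != 0.
  apply/existsP; apply: contraNT v0 => /existsPn u0; rewrite vE.
  rewrite (_ : u = 0) ?scaler0 //; apply/colP=> i; rewrite [RHS]mxE.
  by apply/eqP; rewrite -[_ == _]negbK u0.
have /colP/(_ i) : (largest_invariant_factor (row_mx A w))%:Z *: u
    = u *m (q%:Z *: dsubmx z).
  by rewrite -scalemxAr scalemxAl -vE -PB -e -scalemxAr Pu.
rewrite mxE [RHS]mxE big_ord1 mulrC => /(mulfI ui0) dE.
suff : (q%:Z %| (largest_invariant_factor (row_mx A w))%:Z)%Z by [].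
by rewrite dE mxE dvdz_mulr.
Qed.

(** [P] sends [A x - w] to minus the defect, whatever [x] is, and for [x = Q w] the residual
    [A x - w] is itself minus the defect. *)
Lemma solvable_mod (q : nat) :
  (exists x : 'cV_n, forall i, (q %| ((A *m x - w) i 0)%R)%Z)
    <-> forall i, (q %| (defect i 0)%R)%Z.
Proof.
split=> [[x q_Axw] i | q_v].
  have -> : defect = - (P *m (A *m x - w)).
    by rewrite mulmxBr mulmxA ginv_defect_mul mul0mx sub0r opprK.
  by rewrite mxE rpredN mxE; apply: dvdz_sum => j; rewrite dvdz_mull.
exists (Q *m w) => i; have -> : A *m (Q *m w) - w = - defect.
  by rewrite mulmxBl mul1mx opprB mulmxA.
by rewrite mxE rpredN.
Qed.

Lemma solvable_field (F : numFieldType) :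
  (exists x : 'cV[F]_n, map_mx intr A *m x = map_mx intr w) <-> defect = 0.
Proof.
split=> [[x Ax] | v0].
  have : map_mx (intr : int -> F) defect = 0.
    by rewrite map_mxM -Ax mulmxA -map_mxM ginv_defect_mul map_mx0 mul0mx.
  move=> /colP v0; apply/colP=> i; have := v0 i; rewrite !mxE => /eqP.
  by rewrite intr_eq0 => /eqP.
exists (map_mx intr (Q *m w)); rewrite -map_mxM; congr (map_mx _ _).
by rewrite [RHS]ginv_decomposition (_ : P *m w = 0) ?addr0.
Qed.

(** Rouché-Capelli over the rationals: adjoining [w] keeps the rank iff [w] lies in the column space
    of [A]. Transposing turns column spaces into row spaces. *)
Lemma int_rank_row_mx_eq :
  (int_rank (row_mx A w) == int_rank A) <-> defect = 0.
Proof.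
rewrite -(solvable_field rat) /int_rank map_row_mx.
rewrite -[\rank (row_mx _ _)]mxrank_tr -[\rank (map_mx _ _)]mxrank_tr tr_row_mx.
set a := (map_mx _ A)^T; set b := (map_mx _ w)^T.
have sub_ab : (a <= col_mx a b)%MS by rewrite -addsmxE addsmxSl.
rewrite eq_sym (mxrank_leqif_sup sub_ab) col_mx_sub submx_refl /=.
split=> [/submxP[x bE] | [x Ax]].
  by exists x^T; rewrite -[RHS]trmxK -/b bE trmx_mul trmxK.
by rewrite /b -Ax trmx_mul submxMl.
Qed.

End GeneralizedInverse.

(** * Spanning subgraphs *)

Lemma edge_rows_augmented (n m : nat) (G : ograph n m) (w : 'cV_m) (S : {set 'I_m}) :
  rows S (augmented G w) = row_mx (rows S (incidence G)^T) (rows S w).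
Proof. by apply/matrixP=> i j; rewrite !mxE; case: split => l; rewrite !mxE. Qed.

Section SpanningSubgraph.

Variables (n m : nat) (G : ograph n m) (S : {set 'I_m}).

Local Notation adj := (spanning_adj G S).
Local Notation A := (rows S (incidence G)^T).

Lemma spanning_connect_sym : connect_sym adj.
Proof.
by apply: sym_connect_sym => u v; apply: eq_existsb => e; rewrite orbC.
Qed.

Lemma incidence_mulmx (T : pzRingType) (p : nat) (x : 'M[T]_(n, p)) i j :
  (map_mx intr A *m x) i j
    = x (ehead G (enum_val i)) j - x (etail G (enum_val i)) j.
Proof.
set h := ehead G _; set t := etail G _.
(* For a loop the two indicators cancel, in agreement with the zero column of [incidence]. *)
have E v : (map_mx intr A : 'M[T]__) i v = (v == h)%:R - (v == t)%:R.
  rewrite !mxE -/h -/t; case: (eqVneq t h) => [->|th]; first by rewrite subrr.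
  case: (eqVneq v h) => [->|vh]; first by rewrite eq_sym (negbTE th) subr0.
  by case: eqP => _; rewrite ?mulrNz sub0r ?oppr0.
rewrite mxE (eq_bigr (fun v => (v == h)%:R * x v j - (v == t)%:R * x v j)).
  rewrite sumrB; congr (_ - _).
    rewrite (bigD1 h) //= eqxx mul1r big1 ?addr0 // => v /negbTE->.
    by rewrite mul0r.
  rewrite (bigD1 t) //= eqxx mul1r big1 ?addr0 // => v /negbTE->.
  by rewrite mul0r.
by move=> v _; rewrite E mulrBl.
Qed.

Lemma incidence_mulmx_int (p : nat) (x : 'M[int]_(n, p)) i j :
  (A *m x) i j = x (ehead G (enum_val i)) j - x (etail G (enum_val i)) j.
Proof.
rewrite -incidence_mulmx (_ : map_mx _ _ = A) //.
by apply/matrixP=> a b; rewrite mxE intz.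
Qed.

Lemma connect_invariant (T : Type) (f : 'I_n -> T) :
  (forall e, e \in S -> f (ehead G e) = f (etail G e)) ->
  forall u v, connect adj u v -> f u = f v.
Proof.
move=> fS u v /connectP[s]; elim: s u => [|a s IHs] u /= => [_ ->//|].
case/andP=> /existsP[e /andP[eS uv]] /IHs/[apply] <-.
by case/orP: uv => /andP[/eqP<- /eqP<-]; rewrite fS.
Qed.

(** [lab] numbers the components through their roots and [rep] returns the root, so that functions
    constant on components become functions on ['I_(ncomp G S)]. *)
Lemma component_labels :
  exists (lab : 'I_n -> 'I_(ncomp G S)) (rep : 'I_(ncomp G S) -> 'I_n),
    [/\ cancel rep lab, forall v, connect adj (rep (lab v)) v
      & forall e, e \in S -> lab (ehead G e) = lab (etail G e)].
Proof.
have sym := spanning_connect_sym.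
have rootsP v : fingraph.root adj v \in [predI roots adj & 'I_n].
  by rewrite !inE andbT roots_root.
exists (fun v => enum_rank_in (rootsP v) (fingraph.root adj v)), enum_val.
split=> [i|v|e eS].
- apply: enum_val_inj; rewrite enum_rankK_in //.
  by have := enum_valP i; rewrite !inE andbT => /eqP.
- by rewrite enum_rankK_in // sym connect_root.
- apply: enum_val_inj; rewrite !enum_rankK_in //.
  apply/eqP; rewrite root_connect // connect1 //; apply/existsP.
  by exists e; rewrite eS !eqxx orbT.
Qed.

(** The signed sum of the edge rows along a path telescopes; an edge counts positively when
    traversed from tail to head and negatively otherwise. *)
Lemma path_incidence (u v : 'I_n) :
  connect adj u v ->
  exists p : 'rV[int]_#|S|, p *m A = delta_mx 0 v - delta_mx 0 u.
Proof.
case/connectP=> s; elim: s u => [|a s IHs] u /= => [_ ->|].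
  by exists 0; rewrite mul0mx subrr.
case/andP=> /existsP[e /andP[eS uv]] /IHs/[apply] [] [p pA].
have eA : delta_mx 0 (enum_rank_in eS e) *m A
    = delta_mx 0 (ehead G e) - delta_mx 0 (etail G e) :> 'rV_n.
  rewrite -rowE; apply/rowP=> j.
  have := incidence_mulmx_int 1%:M (enum_rank_in eS e) j.
  by rewrite mulmx1 enum_rankK_in // !mxE eqxx => ->; rewrite ![_ == j]eq_sym.
case/orP: uv => /andP[/eqP tE /eqP hE].
  exists (p + delta_mx 0 (enum_rank_in eS e)).
  by rewrite mulmxDl pA eA tE hE addrA subrK.
exists (p - delta_mx 0 (enum_rank_in eS e)).
by rewrite mulmxBl pA eA tE hE opprB addrA subrK.
Qed.

(* The row of [Q] at [v] sums the edges of a path from a fixed vertex of the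
   component of [v] to [v], so that [Q A x] differs from [x] by a function that
   is constant on components. *)
Lemma incidence_ginv : exists Q : 'M[int]_(n, #|S|), A *m Q *m A = A.
Proof.
have [lab [rep [_ rep_lab labS]]] := component_labels.
have [p pA] := fin_all_exists (fun v => path_incidence (rep_lab v)).
exists (\matrix_v p v); rewrite -mulmxA.
have -> : (\matrix_v p v) *m A = 1%:M - \matrix_v delta_mx 0 (rep (lab v)).
  by apply/row_matrixP=> v; rewrite row_mul rowK pA !linearB /= rowK row1.
rewrite mulmxBr mulmx1; apply/matrixP=> i j; rewrite mxE [X in _ + X]mxE.
by rewrite incidence_mulmx_int !mxE labS ?enum_valP // subrr subr0.
Qed.

(** The rows of [K] are the indicator vectors of the components; evaluating at the representatives
    inverts [K] on the right. *)
Lemma component_indicators (F : fieldType) :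
  exists2 K : 'M[F]_(ncomp G S, n), row_free K &
    forall x : 'rV[F]_n,
      (forall e, e \in S -> x 0 (ehead G e) = x 0 (etail G e)) <->
      (exists y, x = y *m K).
Proof.
have [lab [rep [repK rep_lab labS]]] := component_labels.
have KE (y : 'rV[F]_(ncomp G S)) v :
    (y *m (\matrix_(i, v) (i == lab v)%:R : 'M_(_, n))) 0 v = y 0 (lab v).
  rewrite mxE (bigD1 (lab v)) //= mxE eqxx mulr1 big1 ?addr0 // => i /negbTE i_v.
  by rewrite mxE i_v mulr0.
exists (\matrix_(i, v) (i == lab v)%:R).
  apply/row_freeP; exists (\matrix_(v, i) (v == rep i)%:R).
  apply/row_matrixP=> i; rewrite row_mul; apply/rowP=> j.
  rewrite mxE (bigD1 (rep j)) //= !mxE eqxx repK mulr1 big1 ?addr0 // => v /negbTE vj.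
  by rewrite !mxE vj mulr0.
move=> x; split=> [xS | [y ->] e eS]; last by rewrite !KE labS.
exists (\row_i x 0 (rep i)); apply/rowP=> v; rewrite KE mxE.
by rewrite (connect_invariant xS (rep_lab v)).
Qed.

(** Rank-nullity: the vectors killed by the incidence matrix are those constant on components, a
    space of dimension [ncomp G S]. *)
Lemma rank_incidence : int_rank A = grank G S.
Proof.
have [K K_free KP] := component_indicators rat.
rewrite /int_rank; set a : 'M[rat]_(_, n) := map_mx _ _.
suff : \rank (kermx a^T) = ncomp G S.
  (* The truncated difference in [grank] is exact because the rank is at most [n]. *)
  by rewrite mxrank_ker mxrank_tr /grank => <-; rewrite subKn ?rank_leq_col.
rewrite -(eqP K_free); apply: eqmx_rank; apply/andP; split.
  apply/row_subP=> i; apply/submxP/KP => e eS; apply/eqP.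
  have /(congr1 trmx) : row i (kermx a^T) *m a^T = 0.
    by rewrite -row_mul mulmx_ker linear0.
  rewrite trmx_mul trmxK trmx0 => /matrixP/(_ (enum_rank_in eS e) 0).
  rewrite incidence_mulmx enum_rankK_in // [RHS]mxE => /eqP; rewrite subr_eq0.
  by rewrite [row i _]lock !mxE.
rewrite sub_kermx; apply/eqP/row_matrixP=> i; rewrite row0 row_mul.
apply: trmx_inj; rewrite trmx_mul trmxK trmx0; apply/matrixP=> e j.
rewrite incidence_mulmx [RHS]mxE [row i K]lock !mxE !ord1 -lock.
have [_ /(_ _ _ (enum_valP e))->] := KP (row i K); first by rewrite subrr.
by exists (delta_mx 0 i); rewrite -rowE.
Qed.

Lemma card_constant_on_components (T : finType) :
  #|[set c : {ffun 'I_n -> T} |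
       [forall e in S, c (ehead G e) == c (etail G e)]]%SET| = (#|T| ^ ncomp G S)%N.
Proof.
have [lab [rep [repK rep_lab labS]]] := component_labels.
rewrite -[X in (_ ^ X)%N]card_ord -card_ffun.
pose f (g : {ffun 'I_(ncomp G S) -> T}) : {ffun 'I_n -> T} := [ffun v => g (lab v)].
have f_inj : injective f.
  by move=> g g' /ffunP e; apply/ffunP=> i; have := e (rep i); rewrite !ffunE repK.
rewrite -(card_imset predT f_inj) ; apply: eq_card => c; rewrite !inE.
apply/forall_inP/imsetP => [cS | [g _ ->] e eS]; last by rewrite !ffunE labS.
exists [ffun i => c (rep i)] => //; apply/ffunP=> v; rewrite !ffunE.
have cS' e : e \in S -> c (ehead G e) = c (etail G e) by move/cS/eqP.
by rewrite (connect_invariant cS' (rep_lab v)).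
Qed.

End SpanningSubgraph.

(** * Rank and largest invariant factor of the augmented incidence matrix *)

Section AugmentedIncidence.

Variables (n m : nat) (G : ograph n m) (w : 'cV[int]_m) (S : {set 'I_m}).

Local Notation A := (rows S (incidence G)^T).

Lemma rank_eqP (Q : 'M_(n, #|S|)) :
  A *m Q *m A = A ->
  rank_eq G w S <-> (1%:M - A *m Q) *m rows S w = 0.
Proof.
move=> AQA; rewrite -(int_rank_row_mx_eq _ AQA) /rank_eq edge_rows_augmented.
by rewrite rank_incidence.
Qed.

Lemma rank_eq_solvable (F : numFieldType) :
  rank_eq G w S <->
  exists x : 'I_n -> F,
    forall e, e \in S -> x (ehead G e) - x (etail G e) = (w e 0)%:~R.
Proof.
have [Q AQA] := incidence_ginv G S.
rewrite (rank_eqP AQA) -(solvable_field _ AQA F); split=> [] [x xS].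
  exists (x^~ 0) => e eS; rewrite -[e](enum_rankK_in eS eS) -incidence_mulmx xS.
  by rewrite !mxE.
exists (\col_v x v); apply/colP=> i.
by rewrite incidence_mulmx !mxE xS ?enum_valP.
Qed.

(** When the ranks agree the defect is zero and every [q] divides it; otherwise [q] divides the
    defect iff it divides the largest invariant factor. *)
Lemma dtilde_solvable (q : nat) :
  dtilde G w S q =
  `[< exists x : 'I_n -> int, forall e, e \in S ->
        (q %| x (ehead G e) - x (etail G e) - (w e 0)%R)%Z >]%:R.
Proof.
have [Q AQA] := incidence_ginv G S; pose v := (1%:M - A *m Q) *m rows S w.
have -> : dtilde G w S q = `[< forall i, (q %| (v i 0)%R)%Z >]%:R.
  rewrite /dtilde /dfactor edge_rows_augmented; case: ifPn => [|/negP rk].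
    move/(rank_eqP AQA); rewrite -/v => ->.
    by rewrite asboolT // => i; rewrite mxE dvdz0.
  have v0 : v != 0 by apply: contra_notN rk => /eqP/(rank_eqP AQA).
  have := dvd_largest_invariant_factor_row_mx AQA q v0.
  case: ifP => _ [dv vd]; first by rewrite asboolT //; apply: dv.
  by rewrite asboolF // => /vd.
congr (_%:R); congr (nat_of_bool _); apply: asbool_equiv_eq.
rewrite -(solvable_mod _ AQA q); split=> [] [x xS].
  exists (x^~ 0) => e eS; have := xS (enum_rank_in eS e).
  by rewrite mxE incidence_mulmx_int !mxE enum_rankK_in.
exists (\col_v x v) => i.
by rewrite mxE incidence_mulmx_int !mxE xS ?enum_valP.
Qed.

(** This is the divisibility criterion at [q = 0]: a zero factor would force the defect to
    vanish. *)
Lemma dfactor_gt0 : ~~ rank_eq G w S -> (0 < dfactor G w S)%N.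
Proof.
have [Q AQA] := incidence_ginv G S => /negP rk.
have v0 : (1%:M - A *m Q) *m rows S w != 0.
  by apply: contra_notN rk => /eqP/(rank_eqP AQA).
rewrite lt0n; apply: (contraNneq _ v0) => d0.
have [/(_ _)] := dvd_largest_invariant_factor_row_mx AQA 0 v0.
rewrite -edge_rows_augmented -/(dfactor G w S) d0 dvdnn => /(_ isT) dv _.
apply/eqP/colP=> i; rewrite [RHS]mxE; apply/eqP.
by have := dv i; rewrite dvd0z.
Qed.

End AugmentedIncidence.

(** * Inclusion-exclusion *)

Lemma inclusion_exclusion (T I : finType) (bad : I -> pred T) :
  #|[set c | [forall i, ~~ bad i c]]%SET|%:Z
  = \sum_(S : {set I}) (-1) ^+ #|S| * #|[set c | [forall i in S, bad i c]]%SET|%:Z.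
Proof.
have cardE (P : pred T) : #|[set c | P c]%SET|%:Z = \sum_c (P c)%:R.
  rewrite -sum1_card (eq_bigl P) => [|c]; last by rewrite inE.
  by rewrite big_mkcond /= -natz natr_sum; apply: eq_bigr => c _; case: (P c).
under eq_bigr do rewrite cardE big_distrr /=.
rewrite cardE exchange_big /=; apply: eq_bigr => c _.
(* Pointwise in [c], the indicator of avoiding all bad events is a product; expanding it chooses the
   set [S] of factors contributing [- bad]. *)
have -> : [forall i, ~~ bad i c]%:R = \prod_i (- (bad i c)%:R + 1) :> int.
  case: (boolP [forall i, _]) => [/forallP good | /forallPn[i]].
    by rewrite big1 // => i _; rewrite (negbTE (good i)) oppr0 add0r.
  by rewrite negbK => bad_i; rewrite (bigD1 i) //= bad_i addNr mul0r.
rewrite bigA_distr; apply: eq_bigr => S _; rewrite -big_mkcond /=.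
case: (boolP [forall i in S, _]) => [/forall_inP bad_S | ].
  rewrite mulr1 -prodr_const; apply: eq_bigr => i iS.
  by rewrite (bad_S i iS).
rewrite negb_forall_in => /exists_inP[i iS /negbTE good].
by rewrite (bigD1 i) //= good oppr0 mul0r mulr0.
Qed.

(** * Equations in [Zmod q] as divisibility of integers *)

Section Residues.

Variables (q : nat).
Hypothesis q_gt0 : (0 < q)%N.

Lemma redmod_dvd (x : Zmod q) (z : int) :
  (x == redmod q z) = (q %| (x : nat)%:Z - z)%Z.
Proof.
have q0 : q%:Z != 0 by rewrite -lt0n.
have valE : (val (redmod q z))%:Z = (z %% q)%Z.
  have zq : `|(z %% q)%Z|%:Z = (z %% q)%Z by rewrite gez0_abs ?modz_ge0.
  by rewrite /= prednK // modn_small // -ltz_nat zq ltz_pmod.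
have xE : (val x)%:Z = ((val x)%:Z %% q)%Z.
  by rewrite modz_small //= ltz_nat -[X in (_ < X)%N](prednK q_gt0) ltn_ord.
by rewrite -eqz_mod_dvd -val_eqE -eqz_nat valE {1}xE.
Qed.

Lemma redmod_val (x : Zmod q) : redmod q (val x)%:Z = x.
Proof. by apply/esym/eqP; rewrite redmod_dvd subrr dvdz0. Qed.

Lemma dvd_val_sub (x y : Zmod q) :
  (q %| (val (x - y)%R)%:Z - ((val x)%:Z - (val y)%:Z))%Z.
Proof.
have y_q : (val y <= q)%N by rewrite -[X in (_ <= X)%N](prednK q_gt0) ltnW ?ltn_ord.
(* Subtraction in the ordinal group adds the complement [q - val y]; this natural subtraction is
   exact by [y_q]. *)
have -> : val (x - y) = ((val x + (q - val y)) %% q)%N.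
  by rewrite /= modnDmr; move: (nat_of_ord x) (nat_of_ord y) => a b; rewrite prednK.
rewrite -eqz_mod_dvd -modz_nat modz_mod PoszD -subzn //.
by rewrite addrCA modzDl.
Qed.

Lemma sub_redmod_dvd (x y : Zmod q) (z : int) :
  (x - y == redmod q z) = (q %| (val x)%:Z - (val y)%:Z - z)%Z.
Proof.
have := dvd_val_sub x y; rewrite redmod_dvd -!eqz_mod_dvd.
by move/eqP->.
Qed.

Lemma redmod_eq (a b : int) : (redmod q a == redmod q b) = (q %| a - b)%Z.
Proof.
have aE : (q %| (val (redmod q a))%:Z - a)%Z by rewrite -redmod_dvd.
rewrite redmod_dvd; set r := Posz _ in aE *.
have -> : r - b = (r - a) + (a - b) by ring.
by rewrite rpredDl.
Qed.

Lemma redmod_sub_dvd (a b z : int) :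
  (redmod q a - redmod q b == redmod q z) = (q %| a - b - z)%Z.
Proof.
have valE c : (q %| (val (redmod q c))%:Z - c)%Z by rewrite -redmod_dvd.
rewrite sub_redmod_dvd; set r := Posz (val (redmod q a)); set s := Posz _.
have -> : r - s - z = (r - a) - (s - b) + (a - b - z) by ring.
by rewrite rpredDl //; apply: rpredB; apply: valE.
Qed.

End Residues.

(** * Counting colorings *)

(** The solutions are either absent or a coset of the group of maps constant on components, so
    translating by one solution [c0] counts them. Integer solutions modulo [q] and solutions in
    [Zmod q] correspond through reduction and representatives. *)
Lemma card_partial_colorings (n m : nat) (G : ograph n m) (w : 'cV[int]_m)
    (S : {set 'I_m}) (q : nat) :
  (0 < q)%N ->
  #|[set c : {ffun 'I_n -> Zmod q} | [forall e in S,
       c (ehead G e) - c (etail G e) == redmod q (w e 0)]]%SET|%:Z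
  = dtilde G w S q * q%:Z ^+ ncomp G S.
Proof.
move=> q_gt0; rewrite dtilde_solvable; case: asboolP => [[x xS] | no_sol].
  have [c0 c0S] : exists c0 : {ffun 'I_n -> Zmod q}, forall e, e \in S ->
      c0 (ehead G e) - c0 (etail G e) = redmod q (w e 0).
    exists [ffun v => redmod q (x v)] => e eS; apply/eqP.
    by rewrite !ffunE redmod_sub_dvd // xS.
  pose f (c : {ffun 'I_n -> Zmod q}) : {ffun 'I_n -> Zmod q} := [ffun v => c v + c0 v].
  have f_inj : injective f.
    move=> c c' /ffunP e; apply/ffunP=> v; have := e v; rewrite !ffunE.
    exact: addIr.
  have := card_constant_on_components G S (Zmod q).
  rewrite card_ord [X in (X ^ _)%N]prednK // => cardE.
  rewrite mul1r -[q%:Z]natz -natrX natz -cardE; congr (Posz _).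
  rewrite -[RHS](card_imset _ f_inj).
  apply: eq_card => c; rewrite inE; apply/forall_inP/imsetP => [cS | [c' c'S ->] e eS].
    exists [ffun v => c v - c0 v]; last by apply/ffunP=> v; rewrite !ffunE subrK.
    rewrite inE; apply/forall_inP=> e eS; rewrite !ffunE subr_eq -addrA [- _ + _]addrC.
    by rewrite c0S // -(eqP (cS e eS)) addrC subrK.
  move: c'S; rewrite inE => /forall_inP/(_ e eS)/eqP c'e.
  by rewrite !ffunE c'e opprD addrACA subrr add0r c0S.
rewrite mul0r; apply/eqP; rewrite eqz_nat cards_eq0; apply/eqP/setP=> c.
rewrite !inE; apply/negP=> /forall_inP cS; apply: no_sol.
exists (fun v => (val (c v))%:Z) => e eS.
by rewrite -sub_redmod_dvd // cS.
Qed.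

Lemma card_colorings_subsets (n m : nat) (G : ograph n m) (w : 'cV[int]_m) (q : nat) :
  (0 < q)%N ->
  (#|colorings G (fun e => redmod q (w e 0))|)%:Z
  = \sum_(S : {set 'I_m}) (-1) ^+ #|S| * dtilde G w S q * q%:Z ^+ ncomp G S.
Proof.
move=> q_gt0; rewrite inclusion_exclusion; apply: eq_bigr => S _.
by rewrite card_partial_colorings // mulrA.
Qed.

(** * Flats of the arrangement *)

Section Flats.

Variables (R : realType) (n : nat).

(** The choice made by [xget] is unambiguous: two descriptions of the same affine subspace have base
    points differing by a direction vector, hence equal directions. *)
Lemma affine_dim_translate (p : 'rV[R]_n) (U : {vspace 'rV[R]_n}) :
  affine_dim [set x | x - p \in U]%classic = \dim U.
Proof.
rewrite /affine_dim; apply: xget_unique; first by exists p, U.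
move=> d [p' [U' [/seteqP[sub sub'] <-]]]; congr (\dim _); apply/vspaceP=> u.
have pp' : p' - p \in U by apply: sub'; rewrite /= subrr mem0v.
have p'p : p - p' \in U' by apply: sub; rewrite /= subrr mem0v.
apply/idP/idP=> uU.
  have := sub' (p' + u); rewrite /= [p' + u]addrC addrK => /(_ uU).
  by rewrite -addrA rpredDr.
have := sub (p + u); rewrite /= [p + u]addrC addrK => /(_ uU).
by rewrite -addrA rpredDr.
Qed.

Variables (m : nat) (G : ograph n m) (w : 'cV[int]_m) (S : {set 'I_m}).

Lemma flat_nonempty : (@flat R n m G w S !=set0)%classic <-> rank_eq G w S.
Proof.
rewrite (rank_eq_solvable G w S R); split=> [] [x xS].
  by exists (x 0) => e eS; apply: (xS e).
by exists (\row_v x v) => e /= eS; rewrite /affino_hyperplane /= !mxE xS.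
Qed.

(** From any point [p], the flat is the translate of the row space of [K], and [K] is injective on
    row vectors. *)
Lemma affine_dim_flat : rank_eq G w S -> affine_dim (@flat R n m G w S) = ncomp G S.
Proof.
move/flat_nonempty=> [p pS]; have [K K_free KP] := component_indicators G S R.
pose f : 'Hom('rV[R]_(ncomp G S), 'rV[R]_n) := linfun (mulmxr K).
have -> : @flat R n m G w S = [set x | x - p \in limg f]%classic.
  have diffE (x : 'rV[R]_n) e : e \in S ->
      ((x - p) 0 (ehead G e) == (x - p) 0 (etail G e))
        = (x 0 (ehead G e) - x 0 (etail G e) == (w e 0)%:~R).
    move=> eS; rewrite -[(w e 0)%:~R](pS e eS : _ - _ = _) !mxE.
    by rewrite subr_eq addrAC -addrA addrC -subr_eq.
  apply/seteqP; split=> x /= xS.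
    have [y yK] : exists y, x - p = y *m K.
      by apply/KP => e eS; apply/eqP; rewrite diffE //; apply/eqP/(xS e eS).
    by rewrite yK; apply/memv_imgP; exists y; rewrite ?memvf // lfunE.
  case/memv_imgP: xS => y _; rewrite lfunE /= => yK e /= eS.
  apply/eqP; rewrite -diffE //; apply/eqP.
  by apply: (KP (x - p)).2 => //; exists y.
rewrite affine_dim_translate limg_dim_eq ?dimvf ?/dim /= ?mul1n //.
apply/eqP; rewrite -subv0; apply/subvP=> y; rewrite memv_cap memv_ker lfunE /= => /andP[_].
rewrite memv0; case/row_freeP: K_free => E KE /eqP yK.
by rewrite -[y]mulmx1 -KE mulmxA yK mul0mx.
Qed.

End Flats.

(** * Comparison of the moduli [q] and [p * q] *)

(** Reading representatives in [[0, q)] modulo [p * q] is injective, and an edge equation that holds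
    modulo [p * q] also holds modulo [q], so proper colorings stay proper. *)
Lemma card_colorings_lift (n m : nat) (G : ograph n m) (w : 'cV[int]_m) (p q : nat) :
  (0 < p)%N -> (0 < q)%N ->
  (#|colorings G (fun e => redmod q (w e 0%R))|
     <= #|colorings G (fun e => redmod (p * q) (w e 0%R))|)%N.
Proof.
move=> p_gt0 q_gt0; have pq_gt0 : (0 < p * q)%N by rewrite muln_gt0 p_gt0.
pose f (c : {ffun 'I_n -> Zmod q}) : {ffun 'I_n -> Zmod (p * q)} :=
  [ffun v => redmod (p * q) (val (c v))%:Z].
have f_inj : injective f.
  move=> c c' /ffunP e; apply/ffunP=> v; have /eqP := e v; rewrite !ffunE.
  have q_dvd : (q%:Z %| (p * q)%N%:Z)%Z by rewrite dvdzE /= dvdn_mull.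
  rewrite -[_ == _]/(redmod (p * q) _ == redmod (p * q) _) redmod_eq // => pq_d.
  apply/eqP; rewrite -(redmod_val q_gt0 (c' v)) redmod_dvd //.
  exact: dvdz_trans pq_d.
rewrite -(card_imset _ f_inj); apply: subset_leq_card; apply/fintype.subsetP=> _ /imsetP[c cG ->].
move: cG; rewrite !inE => /forallP cG; apply/forallP=> e.
apply: contra (cG e); rewrite !ffunE redmod_sub_dvd // sub_redmod_dvd //.
by apply: dvdz_trans; rewrite dvdzE /= dvdn_mull.
Qed.

Theorem corollary4p1 (R : realType) (n m : nat) (G : ograph n m) (w : 'cV[int]_m) :
  (forall q : nat, (0 < q)%N ->
     (#|colorings G (fun e => redmod q (w e 0))|)%:Z
     = \sum_(S : {set 'I_m}) (-1) ^+ #|S| * dtilde G w S q * q%:Z ^+ ncomp G S)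
  /\ (exists chi : {poly int},
        (forall q : nat, (qbound G w < q)%N ->
           (#|colorings G (fun e => redmod q (w e 0))|)%:Z = chi.[q%:Z])
        /\ chi = \sum_(S : {set 'I_m} | rank_eq G w S)
                   (-1) ^+ #|S| *: 'X^(ncomp G S)
        /\ chi = arr_charpoly R G w)
  /\ (forall p q : nat, (0 < p)%N -> (0 < q)%N ->
        (#|colorings G (fun e => redmod q (w e 0%R))|
         <= #|colorings G (fun e => redmod (p * q) (w e 0%R))|)%N).
Proof.
split; first exact: card_colorings_subsets.
split; last by move=> p q; apply: card_colorings_lift.
exists (\sum_(S : {set 'I_m} | rank_eq G w S) (-1) ^+ #|S| *: 'X^(ncomp G S)).
split=> [q q_big|]; last split=> //.
  rewrite card_colorings_subsets ?(leq_ltn_trans _ q_big) //.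
  rewrite horner_sum [RHS]big_mkcond /=; apply: eq_bigr => S _.
  rewrite /dtilde; case: ifPn => rk; first by rewrite mulr1 hornerZ hornerXn.
  (* Here [0 < dfactor G w S <= qbound G w < q], so [q] cannot divide the factor and the term
     vanishes. *)
  rewrite gtnNdvd ?mulr0 ?mul0r ?dfactor_gt0 // (leq_ltn_trans _ q_big) //.
  exact: leq_bigmax_cond.
rewrite /arr_charpoly; apply: eq_big => S; last by move=> rk; rewrite affine_dim_flat.
by apply/idP/asboolP => /flat_nonempty.
Qed.
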